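(* Let $A$ be a finitely generated abelian group, let $B=\mathrm{Tor}(A)$ be its torsion subgroup, and let $d\ge 1$. Then the restricted wreath product $G=A\wr\mathbb{Z}^d$ is an automata group of degree $2|B|+4$. In particular, for $A=\mathbb{Z}^l$ (with $l\ge 1$), the degree can be reduced to $4$, that is, $\mathbb{Z}^l\wr\mathbb{Z}^d$ is an automata group of degree $4$.
   Context: For $m\ge1$, $\mathcal{A}_m$ is the automorphism group of the rooted $m$-tree of finite strings over an alphabet $Y$ of size $m$. Each $\alpha\in\mathcal{A}_m$ is written $\alpha=(\alpha_y\mid y\in Y)\sigma(\alpha)$ with $\sigma(\alpha)\in\mathrm{Sym}(Y)$ its action on the first level and states $\alpha_y\in\mathcal{A}_m$ given by $(yu)^\alpha=y^{\sigma(\alpha)}u^{\alpha_y}$. $Q(\alpha)$, the set of states, consists of $\alpha$ and all elements obtained by repeatedly passing to states; $\alpha$ is finite-state if $Q(\alpha)$ is finite. A subgroup of $\mathcal{A}_m$ is state-closed if it contains $Q(\alpha)$ for each of its elements $\alpha$; no transitivity on the first level is required. A group $G$ is an automata group of degree $m$ if it is isomorphic to a subgroup of $\mathcal{A}_m$ which is finitely generated, state-closed, and all of whose elements are finite-state. $A\wr U$ denotes the restricted wreath product $\big(\bigoplus_{u\in U}A\big)\rtimes U$. *)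

(* Defs.v *)
From HB Require Import structures.
From mathcomp Require Import all_boot all_algebra fingroup perm.
From mathcomp Require Import finmap.
From mathcomp Require Import boolp classical_sets functions cardinality.

Set Implicit Arguments.
Unset Strict Implicit.
Unset Printing Implicit Defensive.

Local Open Scope classical_set_scope.
Local Open Scope group_scope.

Definition is_subgroup (G : groupType) (H : set G) : Prop :=
  H 1 /\ forall x y, H x -> H y -> H (x * y^-1).

Definition generated (G : groupType) (S : set G) : set G :=
  smallest (@is_subgroup G) S.

Definition finitely_generated (G : groupType) (H : set G) : Prop :=
  exists S : set G, finite_set S /\ H = generated S.

(* The vertices are the strings over 'I_m, the root is [::], and a string is
   adjacent to its extensions by one letter on the right. *)
Definition tree_edge (m : nat) (u v : seq 'I_m) : bool :=
  [exists y, v == rcons u y] || [exists y, u == rcons v y].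

Record tree_aut (m : nat) := TreeAut {
  tree_fun :> seq 'I_m -> seq 'I_m;
  tree_inv : seq 'I_m -> seq 'I_m;
  tree_funK : cancel tree_fun tree_inv;
  tree_invK : cancel tree_inv tree_fun;
  tree_fun_root : tree_fun [::] = [::];
  tree_fun_edge : forall u v,
    tree_edge (tree_fun u) (tree_fun v) = tree_edge u v }.

HB.instance Definition _ m := gen_eqMixin (tree_aut m).
HB.instance Definition _ m := gen_choiceMixin (tree_aut m).

Section TreeAutGroup.
Variable m : nat.
Implicit Types a b c : tree_aut m.

Lemma tree_autP a b : a =1 b -> a = b.
Proof.
case: a b => [f f' fK f'K f0 fE] [g g' gK g'K g0 gE] /= /funext fg.
move: f fg fK f'K f0 fE => _ -> fK f'K f0 fE.
have E : f' = g' by apply: funext => u; rewrite -{1}(g'K u) fK.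
move: f' E fK f'K => _ -> fK f'K.
by congr TreeAut; apply: Prop_irrelevance.
Qed.

Definition tree_one : tree_aut m :=
  @TreeAut m id id (fun=> erefl) (fun=> erefl) erefl (fun _ _ => erefl).

Lemma tree_mul_root a b : (b \o a) [::] = [::].
Proof. by rewrite /= !tree_fun_root. Qed.

Lemma tree_mul_edge a b u v :
  tree_edge ((b \o a) u) ((b \o a) v) = tree_edge u v.
Proof. by rewrite /= !tree_fun_edge. Qed.

(* Automorphisms act on the right: a * b is a followed by b. *)
Definition tree_mul a b : tree_aut m :=
  TreeAut (can_comp (tree_funK b) (tree_funK a))
          (can_comp (tree_invK a) (tree_invK b))
          (tree_mul_root a b) (tree_mul_edge a b).

Lemma tree_inv_root a : tree_inv a [::] = [::].
Proof. by rewrite -{1}(tree_fun_root a) tree_funK. Qed.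

Lemma tree_inv_edge a u v :
  tree_edge (tree_inv a u) (tree_inv a v) = tree_edge u v.
Proof. by rewrite -(tree_fun_edge a) !tree_invK. Qed.

Definition tree_invg a : tree_aut m :=
  TreeAut (tree_invK a) (tree_funK a) (tree_inv_root a) (@tree_inv_edge a).

Lemma tree_mulA : associative tree_mul.
Proof. by move=> a b c; apply: tree_autP. Qed.
Lemma tree_mul1 : left_id tree_one tree_mul.
Proof. by move=> a; apply: tree_autP. Qed.
Lemma tree_mulr1 : right_id tree_one tree_mul.
Proof. by move=> a; apply: tree_autP. Qed.
Lemma tree_mulV : left_inverse tree_one tree_invg tree_mul.
Proof. by move=> a; apply: tree_autP => u /=; rewrite tree_invK. Qed.
Lemma tree_mulrV : right_inverse tree_one tree_invg tree_mul.
Proof. by move=> a; apply: tree_autP => u /=; rewrite tree_funK. Qed.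

End TreeAutGroup.

HB.instance Definition _ m := isGroup.Build (tree_aut m)
  (@tree_mulA m) (@tree_mul1 m) (@tree_mulr1 m) (@tree_mulV m) (@tree_mulrV m).

Lemma tree_mulE m (a b : tree_aut m) u : (a * b) u = b (a u).
Proof. by []. Qed.

Lemma tree_VK m (a : tree_aut m) : cancel a (a^-1)%g.
Proof. exact: tree_funK. Qed.

Lemma tree_KV m (a : tree_aut m) : cancel (a^-1)%g a.
Proof. exact: tree_invK. Qed.

Section States.
Variable m : nat.
Implicit Types (a : tree_aut m) (u v : seq 'I_m) (y : 'I_m).

Lemma tree_inj a : injective a.
Proof. exact: can_inj (tree_funK a). Qed.

Lemma tree_edge_rcons u y : tree_edge u (rcons u y).
Proof. by apply/orP; left; apply/existsP; exists y. Qed.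

Lemma tree_edgeP u v : tree_edge u v ->
  (exists y, v = rcons u y) \/ (exists y, u = rcons v y).
Proof. by case/orP=> /existsP[y /eqP->]; [left|right]; exists y. Qed.

Lemma tree_rcons a u y : exists z, a (rcons u y) = rcons (a u) z.
Proof.
elim/last_ind: u y => [|u x IH] y.
  have := tree_edge_rcons [::] y.
  rewrite -(tree_fun_edge a) tree_fun_root.
  by case/tree_edgeP=> // -[z]; case: (a _).
have := tree_edge_rcons (rcons u x) y; rewrite -(tree_fun_edge a).
case/tree_edgeP=> // -[z E]; have [t E'] := IH x.
move: E; rewrite E' => /rcons_inj[] /tree_inj E _.
by have := congr1 size E; rewrite !size_rcons => /eqP; rewrite -addn2 -{1}[size u]addn0 eqn_add2l.
Qed.

Lemma tree_head a y :
  exists z, forall u, exists v, a (y :: u) = z :: v.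
Proof.
have [z E] := tree_rcons a [::] y; exists z.
elim/last_ind => [|u x [v IH]].
  by exists [::]; rewrite E tree_fun_root.
rewrite -rcons_cons; have [t ->] := tree_rcons a (y :: u) x.
by rewrite IH; exists (rcons v t).
Qed.

Definition root_fun a y : 'I_m := head y (a [:: y]).

Lemma tree_cons a y u : a (y :: u) = root_fun a y :: behead (a (y :: u)).
Proof.
have [z E] := tree_head a y; rewrite /root_fun.
by have [v ->] := E [::]; have [w ->] := E u.
Qed.

Lemma root_funV a y : root_fun (a^-1) (root_fun a y) = y.
Proof.
by have := tree_VK a [:: y]; rewrite (tree_cons a) (tree_cons a^-1) => -[].
Qed.

(* sigma(a) *)
Definition root_perm a : {perm 'I_m} := perm (can_inj (root_funV a)).

Definition state_fun a y u := behead (a (y :: u)).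

Lemma state_funP a y u : a (y :: u) = root_fun a y :: state_fun a y u.
Proof. exact: tree_cons. Qed.

Lemma state_funK a y :
  cancel (state_fun a y) (state_fun a^-1 (root_fun a y)).
Proof.
move=> u; have := tree_VK a (y :: u).
by rewrite state_funP (state_funP a^-1) => -[].
Qed.

Lemma state_invK a y :
  cancel (state_fun a^-1 (root_fun a y)) (state_fun a y).
Proof.
move=> u; have := tree_KV a (root_fun a y :: u).
by rewrite (state_funP a^-1) root_funV state_funP => -[].
Qed.

Lemma state_fun_root a y : state_fun a y [::] = [::].
Proof.
by rewrite /state_fun; have [z ->] := tree_rcons a [::] y; rewrite tree_fun_root.
Qed.

Lemma tree_edge_cons y u v : tree_edge (y :: u) (y :: v) = tree_edge u v.
Proof.
by congr (_ || _); apply: eq_existsb => x; rewrite rcons_cons eqseq_cons eqxx.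
Qed.

Lemma state_fun_edge a y u v :
  tree_edge (state_fun a y u) (state_fun a y v) = tree_edge u v.
Proof.
by rewrite -(tree_edge_cons (root_fun a y)) -!state_funP tree_fun_edge tree_edge_cons.
Qed.

Definition state a y : tree_aut m :=
  TreeAut (@state_funK a y) (@state_invK a y) (state_fun_root a y)
          (@state_fun_edge a y).

(* (yu)^a = y^sigma(a) u^(a_y), which determines both sigma(a) and a_y. *)
Lemma stateP a y u : a (y :: u) = root_perm a y :: state a y u.
Proof. by rewrite permE -state_funP. Qed.

(* Q(a): the iterated states of a, the empty string giving a itself. *)
Definition states a : set (tree_aut m) := range (foldl state a).

Definition finite_state a : Prop := finite_set (states a).

End States.

Definition state_closed (m : nat) (H : set (tree_aut m)) : Prop :=
  forall a, H a -> states a `<=` H.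

Definition is_automata_group (m : nat) (G : groupType) : Prop :=
  exists H : set (tree_aut m),
    [/\ is_subgroup H, finitely_generated H, state_closed H,
        (forall a, H a -> finite_state a)
      & exists f : {multiplicative G -> tree_aut m}, injective f /\ range f = H].

(* wr_base is an element of the direct sum of copies of A indexed by U. *)
Record wreath (A U : groupType) := Wreath {
  wr_base : U -> A;
  wr_top : U;
  wr_finsupp : finite_set [set x | wr_base x != 1] }.

HB.instance Definition _ (A U : groupType) := gen_eqMixin (wreath A U).
HB.instance Definition _ (A U : groupType) := gen_choiceMixin (wreath A U).

Section WreathGroup.
Variables A U : groupType.
Implicit Types p q r : wreath A U.

Lemma wreathP p q : wr_base p =1 wr_base q -> wr_top p = wr_top q -> p = q.
Proof.
case: p q => [f u fP] [g v gP] /= /funext fg uv.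
move: f fg fP => _ -> fP; rewrite uv.
by congr Wreath; apply: Prop_irrelevance.
Qed.

Lemma wr_one_finsupp : finite_set [set x : U | (1 : A) != 1].
Proof. by rewrite (_ : mkset _ = set0) //; apply/seteqP; split=> x //=; rewrite eqxx. Qed.

Definition wr_one : wreath A U := @Wreath A U (fun=> 1) 1 wr_one_finsupp.

Lemma wr_mul_finsupp p q :
  finite_set [set x | wr_base p x * wr_base q ((wr_top p)^-1 * x) != 1].
Proof.
apply: (@sub_finite_set _ _ ([set x | wr_base p x != 1] `|`
    (fun x => wr_top p * x) @` [set x | wr_base q x != 1])).
  move=> x /= pq; have [px|px] := eqVneq (wr_base p x) 1; last by left.
  right; exists ((wr_top p)^-1 * x); last by rewrite mulVKg.
  by move: pq; rewrite px mul1g.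
rewrite finite_setU; split; first exact: wr_finsupp.
exact/finite_image/wr_finsupp.
Qed.

(* U acts on the direct sum by translation, (u.g)(x) = g (u^-1 x). *)
Definition wr_mul p q : wreath A U :=
  @Wreath A U (fun x => wr_base p x * wr_base q ((wr_top p)^-1 * x))
    (wr_top p * wr_top q) (@wr_mul_finsupp p q).

Lemma wr_inv_finsupp p :
  finite_set [set x | (wr_base p (wr_top p * x))^-1 != 1].
Proof.
apply: (@sub_finite_set _ _ ((fun x => (wr_top p)^-1 * x) @`
    [set x | wr_base p x != 1])).
  move=> x /=; rewrite invg_eq1 => px.
  by exists (wr_top p * x) => //; rewrite mulKg.
exact/finite_image/wr_finsupp.
Qed.

Definition wr_inv p : wreath A U :=
  @Wreath A U (fun x => (wr_base p (wr_top p * x))^-1) (wr_top p)^-1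
    (@wr_inv_finsupp p).

Lemma wr_mulA : associative wr_mul.
Proof. by move=> p q r; apply: wreathP => [x|] /=; rewrite ?invgM !mulgA. Qed.
Lemma wr_mul1 : left_id wr_one wr_mul.
Proof. by move=> p; apply: wreathP => [x|] /=; rewrite ?invg1 !mul1g. Qed.
Lemma wr_mulr1 : right_id wr_one wr_mul.
Proof. by move=> p; apply: wreathP => [x|] /=; rewrite !mulg1. Qed.
Lemma wr_mulV : left_inverse wr_one wr_inv wr_mul.
Proof. by move=> p; apply: wreathP => [x|] /=; rewrite ?invgK mulVg. Qed.
Lemma wr_mulrV : right_inverse wr_one wr_inv wr_mul.
Proof. by move=> p; apply: wreathP => [x|] /=; rewrite ?mulVKg mulgV. Qed.

End WreathGroup.

HB.instance Definition _ (A U : groupType) := isGroup.Build (wreath A U)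
  (@wr_mulA A U) (@wr_mul1 A U) (@wr_mulr1 A U) (@wr_mulV A U) (@wr_mulrV A U).

(* Abelian groups are written additively, as zmodTypes; to_multiplicative is
   the same group in multiplicative notation. *)

Definition torsion (A : zmodType) : set A :=
  [set a | exists n : nat, (0 < n)%N /\ (a *+ n = 0)%R].
Arguments torsion A : clear implicits.

Definition free_abelian (d : nat) : groupType := Algebra.to_multiplicative 'rV[int]_d.

(* Main.v *)
Require Import Defs.
From HB Require Import structures.
From mathcomp Require Import all_boot all_algebra.
From mathcomp Require Import finmap zify.
From mathcomp Require Import boolp classical_sets functions cardinality fsbigop.

(** A group G with an action on an alphabet X and a section map from G x X to G
that is a cocycle for this action ([recursion] below) acts on the tree of words
over X, section by section.  The image of G in the automorphism group of the
tree is state-closed because the states of g are its sections.  Hence a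
finitely generated G is an automata group of degree #|X| as soon as the action
on words is faithful and every element has finitely many iterated sections
([recursion_automata]).  Elements with finitely many sections form a subgroup,
so that only generators have to be examined.

Suppose that an abelian group A has such a recursion over X.  The group
U = Z^d has one over bool, the odometer: for an injective endomorphism [shift]
with image of index 2, serving as the base of a number system with digits 0
and 1, u is added to a last digit, and its section is the carry.  The maps
[tile x] sending z to shift z minus the digit x cut U into two translates of
this image, compatibly with the action of U.  The wreath product A wr U then has
the following recursion over bool + X ([wreath_rec]).
 - On bool, the top component acts as the odometer, and the section at x
   restricts the base function to the tile x, reread as a function on U.
 - On X, an element acts through the sum in A of the values of its base
   function; the section, an element of A, is put back at the identity of U.
If an element fixes every word, then its top component is trivial, and so is
the sum of its base function over each iterated tile, since these sums act
trivially on the words over X.  Iterated tiles separate points, because no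
nonzero vector is infinitely divisible by [shift]; so the base function, whose
support is finite, vanishes ([tile_sums_eq0]).  On generators the sections are
visibly finite: those of an element of A placed at 1 are of the same kind,
because 1 is the only point that a tile map sends to 1.  Therefore A wr Z^d is
an automata group of degree 2 + #|X| ([wreath_automata]).

The odometer also serves for A = Z^l, which gives degree 4.  A general finitely
generated A splits as B + Z^r ([fg_abelian_split]); the odometer on the free
part together with the translation action of B on 2|B| letters is a recursion
over 2 + 2|B| letters, which gives degree 2|B| + 4. *)

Set Implicit Arguments.
Unset Strict Implicit.
Unset Printing Implicit Defensive.

Local Open Scope classical_set_scope.
Local Open Scope group_scope.

(** * Subgroups and generation *)

Section Generation.
Variable G : groupType.
Implicit Types (H K S : set G).

Lemma is_subgroupV H x : is_subgroup H -> H x -> H x^-1.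
Proof. by case=> H1 HM Hx; rewrite -[x^-1]mul1g; apply: HM. Qed.

Lemma is_subgroupM H x y : is_subgroup H -> H x -> H y -> H (x * y).
Proof.
move=> sH Hx Hy; rewrite -[y]invgK; apply: sH.2 => //; exact: is_subgroupV.
Qed.

Lemma generated_subgroup S : is_subgroup (generated S).
Proof.
split=> [|x y Sx Sy] K [sK SK]; first exact: sK.1.
by apply: sK.2; [apply: Sx | apply: Sy].
Qed.

Lemma sub_generated S : S `<=` generated S.
Proof. exact: sub_smallest. Qed.

Lemma generated_ind S K : is_subgroup K -> S `<=` K -> generated S `<=` K.
Proof. by move=> sK SK x; apply. Qed.

End Generation.

Section GenerationMorphism.
Variables (G : groupType).
Implicit Types (S : set G).

Lemma preimage_subgroup (L : groupType) (f : G -> L) (K : set L) :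
  {morph f : x y / x * y} -> is_subgroup K -> is_subgroup (f @^-1` K).
Proof.
move=> fM sK; have f1 : f 1 = 1.
  by apply: (mulgI (f 1)); rewrite -fM !mulg1.
have fV x : f x^-1 = (f x)^-1.
  by apply: (mulgI (f x)); rewrite -fM !mulgV.
split=> [|x y] /=; first by rewrite f1; exact: sK.1.
by rewrite fM fV; exact: sK.2.
Qed.

Lemma range_generated (L : groupType) (f : G -> L) S :
  {morph f : x y / x * y} -> [set: G] = generated S ->
  is_subgroup (range f) /\ range f = generated (f @` S).
Proof.
move=> fM GS; have sR : is_subgroup (range f).
  split; first by exists 1 => //; apply: (mulgI (f 1)); rewrite -fM !mulg1.
  move=> _ _ [x _ <-] [y _ <-]; exists (x * y^-1) => //.
  by apply: (mulIg (f y)); rewrite -fM !mulgVK.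
split=> //; apply/seteqP; split; last first.
  by apply: (generated_ind sR) => _ [x _ <-]; exists x.
have sub : generated S `<=` f @^-1` generated (f @` S).
  apply: (generated_ind (preimage_subgroup fM (@generated_subgroup _ _))).
  by move=> x Sx; apply: sub_generated; exists x.
by move=> _ [x _ <-]; apply: sub; rewrite -GS.
Qed.

End GenerationMorphism.

(** * Self-similar recursions and their tree representations *)

(** The data of the equations g = (g_x | x in X) sigma(g), for the right-action
convention: [rsecM] is the law (gh)_x = g_x h_(x^g) for states. *)
Record recursion (G : groupType) (X : Type) := Recursion {
  ract : G -> X -> X;
  rsec : G -> X -> G;
  ract1 : forall x, ract 1 x = x;
  ractM : forall g h x, ract (g * h) x = ract h (ract g x);
  rsecM : forall g h x, rsec (g * h) x = rsec g x * rsec h (ract g x) }.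

Section Recursion.
Variables (G : groupType) (X : Type) (R : recursion G X).
Implicit Types (g h : G) (x : X) (w : seq X).

Fixpoint word_act g w : seq X :=
  if w is x :: w' then ract R g x :: word_act (rsec R g x) w' else [::].

Definition fixes_words g := forall w, word_act g w = w.

Definition faithful := forall g, fixes_words g -> g = 1.

(** Asking for a finite set that contains g and is closed under sections, rather
than for a finite set of iterated sections, avoids any reference to words. *)
Definition finite_sections g := exists S : set G,
  [/\ finite_set S, S g & forall h x, S h -> S (rsec R h x)].

Lemma rsec1 x : rsec R 1 x = 1.
Proof.
apply: (mulgI (rsec R 1 x)).
by rewrite -{2}(ract1 R x) -rsecM !mulg1.
Qed.

Lemma word_act1 w : word_act 1 w = w.
Proof. by elim: w => //= x w IH; rewrite ract1 rsec1 IH. Qed.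

Lemma word_actM g h w : word_act (g * h) w = word_act h (word_act g w).
Proof. by elim: w g h => //= x w IH g h; rewrite ractM rsecM IH. Qed.

Lemma word_actK g : cancel (word_act g) (word_act g^-1).
Proof. by move=> w; rewrite -word_actM mulgV word_act1. Qed.

Lemma word_actVK g : cancel (word_act g^-1) (word_act g).
Proof. by move=> w; rewrite -word_actM mulVg word_act1. Qed.

Lemma fixes_words_sec g x : fixes_words g -> fixes_words (rsec R g x).
Proof. by move=> gP w; have := gP (x :: w) => -[]. Qed.

(** The sections of a product are products of sections, so S S' is closed under
sections whenever S and S' are. *)
Lemma finite_sections_subgroup : is_subgroup finite_sections.
Proof.
split.
  exists [set 1]; split=> // h x ->; exact: rsec1.
move=> g h [S [Sf Sg Ss]] [T [Tf Th Ts]].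
exists [set p.1 * p.2^-1 | p in S `*` T]; split.
- exact/finite_image/finite_setX.
- by exists (g, h).
move=> _ x [[a b] [/= Sa Tb] <-].
exists (rsec R a x, rsec R b (ract R b^-1 (ract R a x))) => /=.
  by split; [apply: Ss | apply: Ts].
rewrite rsecM; congr (_ * _).
set y := ract R a x.
apply: (mulIg (rsec R b (ract R b^-1 y))).
by rewrite mulVg -rsecM mulVg rsec1.
Qed.

End Recursion.

Section Realization.
Variables (G : groupType) (m : nat) (R : recursion G 'I_m).

(** Prefixes are preserved, so the action on words is one on the tree. *)
Lemma word_act_rcons g w x :
  exists y, word_act R g (rcons w x) = rcons (word_act R g w) y.
Proof.
elim: w g => [|z w IH] g /=; first by exists (ract R g x).
by have [y ->] := IH (rsec R g z); exists y.
Qed.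

Lemma word_act_edge g u v :
  tree_edge (word_act R g u) (word_act R g v) = tree_edge u v.
Proof.
have fwd h u' v' : tree_edge u' v' ->
    tree_edge (word_act R h u') (word_act R h v').
  case/tree_edgeP=> -[y ->].
    by have [z ->] := word_act_rcons h u' y; exact: tree_edge_rcons.
  have [z ->] := word_act_rcons h v' y.
  by apply/orP; right; apply/existsP; exists z.
by apply/idP/idP => [/(fwd g^-1)|/fwd //]; rewrite !word_actK.
Qed.

Definition rec_tree g : tree_aut m :=
  @TreeAut m (word_act R g) (word_act R g^-1) (word_actK R g)
    (word_actVK R g) erefl (word_act_edge g).

Lemma rec_treeM : {morph rec_tree : g h / g * h}.
Proof. by move=> g h; apply: tree_autP => w /=; rewrite word_actM. Qed.

HB.instance Definition _ :=
  isMultiplicative.Build G (tree_aut m) rec_tree rec_treeM.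

Lemma rec_tree_state g y : state (rec_tree g) y = rec_tree (rsec R g y).
Proof. by apply: tree_autP. Qed.

(** Iterated states are images of iterated sections; the latter are described by
the section-closed sets that contain them. *)
Lemma rec_tree_foldl g w :
  exists2 h, foldl (@state m) (rec_tree g) w = rec_tree h &
  forall S : set G, S g -> (forall k x, S k -> S (rsec R k x)) -> S h.
Proof.
elim: w g => [|y w IH] g /=; first by exists g.
rewrite rec_tree_state; have [h -> hP] := IH (rsec R g y).
by exists h => // S Sg Ss; apply: hP => //; apply: Ss.
Qed.

Lemma recursion_automata_ord :
  finitely_generated [set: G] -> faithful R ->
  (forall g, finite_sections R g) -> is_automata_group m G.
Proof.
move=> [S [Sfin GS]] Rf Rfin; exists (range rec_tree).
have [sR Rgen] := range_generated rec_treeM GS.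
split=> //.
- by exists (rec_tree @` S); split=> //; apply: finite_image.
- move=> _ [g _ <-] _ [w _ <-]; have [h -> _] := rec_tree_foldl g w.
  by exists h.
- move=> _ [g _ <-]; have [T [Tfin Tg Ts]] := Rfin g.
  apply: (@sub_finite_set _ _ (rec_tree @` T)); last exact: finite_image.
  move=> _ [w _ <-]; have [h -> hP] := rec_tree_foldl g w.
  by exists h => //; apply: hP.
exists rec_tree; split=> // g h gh.
apply: (mulIg h^-1); rewrite mulgV; apply: Rf => w.
have := congr1 (fun a : tree_aut m => a w) gh => /= E.
by rewrite word_actM E word_actK.
Qed.

End Realization.

Section Relabelling.
Variables (G : groupType) (X Y : Type) (f : X -> Y) (f' : Y -> X).
Hypotheses (fK : cancel f f') (f'K : cancel f' f).
Variable R : recursion G X.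

Definition relabel : recursion G Y.
Proof.
refine (@Recursion G Y (fun g y => f (ract R g (f' y)))
  (fun g y => rsec R g (f' y)) _ _ _).
- by move=> y; rewrite ract1 f'K.
- by move=> g h y; rewrite fK ractM.
- by move=> g h y; rewrite fK rsecM.
Defined.

Lemma word_act_relabel g w :
  word_act relabel g (map f w) = map f (word_act R g w).
Proof. by elim: w g => //= x w IH g; rewrite fK IH. Qed.

Lemma relabel_faithful : faithful R -> faithful relabel.
Proof.
move=> Rf g gP; apply: Rf => w.
by apply: (inj_map (can_inj fK)); rewrite -word_act_relabel gP.
Qed.

Lemma relabel_finite g : finite_sections R g -> finite_sections relabel g.
Proof. by case=> S [Sf Sg Ss]; exists S; split=> // h x; exact: Ss. Qed.

End Relabelling.

Theorem recursion_automata (G : groupType) (X : finType)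
    (R : recursion G X) :
  finitely_generated [set: G] -> faithful R ->
  (forall g, finite_sections R g) -> is_automata_group #|X| G.
Proof.
move=> Gfg Rf Rfin.
apply: (recursion_automata_ord
  (R := relabel (@enum_rankK X) (@enum_valK X) R)) => //.
  exact: relabel_faithful.
by move=> g; apply: relabel_finite.
Qed.
Section Combinators.
Variable G : groupType.

(** ** Building recursions *)

Section Sum.
Variables (X1 X2 : Type) (R1 : recursion G X1) (R2 : recursion G X2).

Definition sum_rec : recursion G (X1 + X2).
Proof.
refine (@Recursion G (X1 + X2)
  (fun g x => match x with inl y => inl (ract R1 g y)
                         | inr y => inr (ract R2 g y) end)
  (fun g x => match x with inl y => rsec R1 g y
                         | inr y => rsec R2 g y end) _ _ _).
- by case=> x; rewrite ract1.
- by move=> g h [] x; rewrite ractM.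
- by move=> g h [] x; rewrite rsecM.
Defined.

Lemma fixes_words_sum g :
  fixes_words sum_rec g -> fixes_words R1 g /\ fixes_words R2 g.
Proof.
move=> gP; split=> w.
  have: word_act sum_rec g (map inl w) = map inl (word_act R1 g w).
    by elim: w (g) => //= x w IH h; rewrite IH.
  by rewrite gP => /(inj_map (fun x y => @inl_inj _ _ x y)).
have: word_act sum_rec g (map inr w) = map inr (word_act R2 g w).
  by elim: w (g) => //= x w IH h; rewrite IH.
by rewrite gP => /(inj_map (fun x y => @inr_inj _ _ x y)).
Qed.

End Sum.

(** A recursion of A serves for any G mapping to A, provided that sections in A
can be put back in G by a homomorphism i.  When p is a retraction of i, nothing
of p g is lost: the word action of g is that of p g. *)
Section Pull.
Variables (A : groupType) (X : Type) (R : recursion A X).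
Variables (p : G -> A) (i : A -> G).
Hypotheses (pM : {morph p : x y / x * y}) (iM : {morph i : x y / x * y}).

Definition pull_rec : recursion G X.
Proof.
refine (@Recursion G X (fun g => ract R (p g))
  (fun g x => i (rsec R (p g) x)) _ _ _).
- have -> : p 1 = 1 by apply: (mulgI (p 1)); rewrite -pM !mulg1.
  exact: ract1.
- by move=> g h x; rewrite pM ractM.
- by move=> g h x; rewrite pM rsecM iM.
Defined.

Lemma fixes_words_pull g :
  cancel i p -> fixes_words pull_rec g -> fixes_words R (p g).
Proof.
move=> iK gP w; rewrite -[RHS]gP.
elim: w g {gP} => //= x w IH g; congr cons.
by rewrite -IH iK.
Qed.

End Pull.

(** An action on letters, extended to words by acting on the first letter. *)
Section Permutations.
Variables (X : Type) (f : G -> X -> X).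
Hypotheses (f1 : forall x, f 1 x = x).
Hypotheses (fM : forall g h x, f (g * h) x = f h (f g x)).

Definition perm_rec : recursion G X :=
  @Recursion G X f (fun _ _ => 1) f1 fM (fun _ _ _ => esym (mulg1 1)).

End Permutations.

End Combinators.

(** * Free abelian groups *)

Section FreeAbelian.
Import GRing.Theory.
Local Open Scope ring_scope.

Lemma free_abelian_ind n (K : set (free_abelian n)) :
  is_subgroup K -> (forall j, K (delta_mx 0 j : 'rV[int]_n)) ->
  forall v, K v.
Proof.
move=> sK Kd v.
have KD (x y : 'rV[int]_n) : K x -> K y -> K (x + y).
  by exact: (@is_subgroupM (free_abelian n)).
have KN (x : 'rV[int]_n) : K x -> K (- x).
  by exact: (@is_subgroupV (free_abelian n)).
have K0 : K (0 : 'rV[int]_n) by case: sK.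
rewrite [v]row_sum_delta; apply: (big_ind K) => // j _.
have Kn k : K ((delta_mx 0 j : 'rV[int]_n) *+ k).
  by elim: k => [|k IH]; rewrite ?mulr0n ?mulrS //; apply: KD.
rewrite -[v 0 j]intz scaler_int; case: (v 0 j) => k /=; first exact: Kn.
by rewrite NegzE mulrNz; apply: KN; exact: Kn.
Qed.

Lemma free_abelian_fg n : finitely_generated [set: free_abelian n].
Proof.
exists (range (fun j => delta_mx 0 j : 'rV[int]_n)); split.
  exact/finite_image/finite_finset.
apply/seteqP; split=> // v _.
apply: free_abelian_ind; first exact: generated_subgroup.
by move=> j; apply: sub_generated; exists j.
Qed.

Section Odometer.
Variable n : nat.
Local Notation V := 'rV[int]_n.+1.
Implicit Types (u v y z : V) (x : bool).

(** The generalized doubling (z_0, ..., z_n) |-> (2 z_n, z_0, ..., z_(n-1)); its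
(n+1)-st power is multiplication by 2, but its image has only index 2, whence
two letters whatever the rank. *)
Definition shift z : V :=
  \row_i if unlift ord0 i is Some k then z 0 (lift ord_max k)
         else 2 * z 0 ord_max.

Definition unshift y : V :=
  \row_i if unlift ord_max i is Some k then y 0 (lift ord0 k)
         else (y 0%R ord0 %/ 2)%Z.

Definition digit x : V := x%:R *: delta_mx 0 ord0.

Lemma shiftB : {morph shift : y z / y - z}.
Proof.
move=> y z; apply/rowP => i; rewrite !mxE.
by case: unliftP => [k _|_]; rewrite ?mxE ?mulrBr.
Qed.

Lemma shift0 : shift 0 = 0.
Proof. by have := shiftB 0 0; rewrite !subrr. Qed.

Lemma shiftD : {morph shift : y z / y + z}.
Proof. by move=> y z; rewrite -[LHS](subrK (shift z)) -shiftB addrK. Qed.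

Lemma shiftK : cancel shift unshift.
Proof.
move=> z; apply/rowP => i; rewrite !mxE.
case: unliftP => [k ->|->]; rewrite ?mxE ?liftK //.
by rewrite unlift_none mulrC mulzK.
Qed.

Lemma unshiftK y : (2 %| y 0%R ord0)%Z -> shift (unshift y) = y.
Proof.
move=> y2; apply/rowP => i; rewrite !mxE.
case: unliftP => [k ->|->]; rewrite ?mxE ?liftK //.
by rewrite unlift_none mulrC divzK.
Qed.

Definition parity y : bool := ~~ (2 %| y 0%R ord0)%Z.

Definition flip u x : bool := x (+) parity u.

(** Adding u to the number with last digit x leaves the last digit [flip u x]
and this carry, in the number system of base [shift] and digits 0, 1. *)
Definition carry u x : V := unshift (digit x + u - digit (flip u x)).

Lemma shift_carry u x : shift (carry u x) = digit x + u - digit (flip u x).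
Proof.
apply: unshiftK; rewrite !mxE eqxx /flip /parity.
by case: x => /=; lia.
Qed.

Lemma flip0 x : flip 0 x = x.
Proof. by rewrite /flip /parity mxE addbF. Qed.

Lemma flipD u v x : flip (u + v) x = flip v (flip u x).
Proof. by rewrite /flip /parity !mxE; case: x => /=; lia. Qed.

Lemma carryD u v x : carry (u + v) x = carry u x + carry v (flip u x).
Proof.
apply: (can_inj shiftK); rewrite shiftD /= !shift_carry flipD.
by rewrite !addrA subrK.
Qed.

Definition odometer : recursion (free_abelian n.+1) bool :=
  @Recursion (free_abelian n.+1) bool flip carry flip0 flipD carryD.

(** The coefficients n+1, ..., 2n+1 increase by one along the cyclic shift, and
twice the first exceeds the last by one as well; so [shift] increases the weight
of z by exactly the sum of the `|z_i|. *)
Definition weight z : nat := (\sum_(i < n.+1) (n.+1 + i) * `|z 0%R i|)%N.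

Lemma weight_shift z :
  weight (shift z) = (weight z + \sum_(i < n.+1) `|z 0%R i|)%N.
Proof.
rewrite /weight -big_split big_ord_recl [RHS]big_ord_recr /= addnC.
congr (_ + _)%N; last by rewrite mxE unlift_none; lia.
apply: eq_bigr => i _; rewrite mxE liftK; set t := lift ord_max i.
have -> : widen_ord (leqnSn n) i = t.
  by apply: val_inj; exact: esym (lift_max i).
by rewrite /bump leq0n; lia.
Qed.

(** Dividing a nonzero vector by [shift] lowers its weight, so no nonzero vector
can be divided forever.  The set D is the invariant of such a division. *)
Lemma shift_divisible0 (D : set V) :
  (forall v, D v -> exists2 v', v = shift v' & D v') -> forall v, D v -> v = 0.
Proof.
move=> Dshift v; have [k] := ubnP (weight v).
elim: k v => // k IH v vk Dv; have [v' v'E Dv'] := Dshift v Dv.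
have [//|vN0] := eqVneq v 0.
suff v'0 : v' = 0 by rewrite v'E v'0 shift0.
apply: IH => //; move: vk; rewrite v'E weight_shift.
have : (0 < \sum_(i < n.+1) `|v' 0%R i|)%N.
  rewrite lt0n sum_nat_eq0; apply: contra vN0 => /forallP v'0.
  rewrite v'E (_ : v' = 0) ?shift0 //; apply/rowP => i; rewrite mxE.
  by have := v'0 i; rewrite absz_eq0 => /eqP.
lia.
Qed.

Lemma odometer_faithful : faithful odometer.
Proof.
apply: shift_divisible0 => v vP; exists (carry v false).
  have vE : flip v false = false by have [] := vP [:: false].
  by rewrite shift_carry vE addrAC subrr add0r.
exact: (@fixes_words_sec _ _ odometer v false vP).
Qed.

Lemma shift_delta (k : 'I_n) :
  shift (delta_mx 0 (lift ord_max k)) = delta_mx 0 (lift ord0 k).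
Proof.
apply/rowP => i; rewrite mxE.
case: unliftP => [j ->|->]; rewrite !mxE /=.
  by rewrite !(inj_eq lift_inj).
by rewrite (negPf (neq_lift _ _)) mulr0.
Qed.

Lemma shift_delta_max : shift (delta_mx 0 ord_max) = delta_mx 0 ord0 *+ 2.
Proof.
apply/rowP => i; rewrite mxE.
case: unliftP => [j ->|->]; rewrite !mxE /= ?eqxx //.
by rewrite ![lift _ _ == _]eq_sym !(negPf (neq_lift _ _)).
Qed.

(** The set of the e_k together with 0 is closed under sections: the carry of
e_(k+1) is e_k, and that of e_0 is 0 or the last basis vector. *)
Lemma odometer_finite v : finite_sections odometer v.
Proof.
apply: (@free_abelian_ind n.+1); first exact: finite_sections_subgroup.
pose S : set V := 0 |` range (delta_mx 0).
move=> j; exists S; split.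
- rewrite finite_setU; split; first exact: finite_set1.
  exact/finite_image/finite_finset.
- by right; exists j.
have S0 x : S (carry 0 x).
  left; apply: (can_inj shiftK).
  by rewrite shift_carry flip0 addrAC subrr add0r shift0.
have carryE (u w : V) x : digit x + u - digit (flip u x) = shift w ->
    carry u x = w.
  by move=> uw; apply: (can_inj shiftK); rewrite shift_carry.
move=> h x [->|[k _ <-]]; first exact: S0.
case: (unliftP ord0 k) => [i ->|->].
  right; exists (lift ord_max i) => //; apply/esym/carryE.
  rewrite shift_delta /flip /parity mxE eqxx /= addbF.
  by rewrite addrAC subrr add0r.
case: x; [right; exists ord_max => //; apply/esym/carryE | left; apply/carryE].
  rewrite shift_delta_max /flip /parity mxE !eqxx /digit scale1r scale0r subr0.
  by rewrite mulr2n.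
by rewrite shift0 /flip /parity mxE !eqxx /digit scale1r scale0r add0r subrr.
Qed.

(** [tile x] numbers by U the vectors of parity x. *)
Definition tile x z : V := shift z - digit x.

Lemma tile_inj x : injective (tile x).
Proof. by move=> y z /addIr/(can_inj shiftK). Qed.

Lemma tile_surj y : exists x z, y = tile x z.
Proof.
exists (parity y), (unshift (y + digit (parity y))).
rewrite /tile unshiftK ?addrK // !mxE /parity eqxx.
by case: (boolP (2 %| y 0%R ord0)%Z) => /=; lia.
Qed.

Lemma parity_tile x z : parity (tile x z) = x.
Proof.
by rewrite /parity !mxE unlift_none eqxx; case: x => /=; lia.
Qed.

(** The defining equation of the carry, read as: translation by u permutes the
two tiles, and acts inside each of them as translation by the carry. *)
Lemma tile_equivariant u x z : tile x z - u = tile (flip u x) (z - carry u x).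
Proof.
rewrite /tile shiftB /= shift_carry; apply/eqP.
rewrite !opprD !opprK !addrA addrK.
by rewrite addrAC.
Qed.

Lemma tile_eq0 x z : tile x z = 0 -> z = 0.
Proof.
move=> xz; have := parity_tile x z; rewrite xz /parity mxE /= => x0.
by apply: (can_inj shiftK); rewrite shift0 -xz /tile -x0 /digit scale0r subr0.
Qed.

End Odometer.
End FreeAbelian.
Lemma free_abelian_recursion r : exists R : recursion (free_abelian r) bool,
  faithful R /\ forall v, finite_sections R v.
Proof.
case: r => [|n]; last first.
  exists (odometer n); split; first exact: odometer_faithful.
  exact: odometer_finite.
pose R : recursion (free_abelian 0) bool :=
  perm_rec (fun _ => erefl) (fun _ _ _ => erefl).
exists R; split=> [v _|v]; first exact: thinmx0.
by exists [set 1; v]; split=> [||h x _]; [exact: finite_set2 | right | left].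
Qed.

(** * Wreath products *)

Section WreathGenerators.
Variables A U : groupType.
Local Notation W := (wreath A U).

Lemma wr_delta_finsupp (a : A) :
  finite_set [set x : U | (if x == 1 then a else 1) != 1].
Proof.
apply: (@sub_finite_set _ _ [set 1]); last exact: finite_set1.
by move=> x /=; have [->|] := eqVneq x 1; rewrite ?eqxx.
Qed.

Definition wr_delta (a : A) : W := Wreath 1 (wr_delta_finsupp a).

Definition wr_translation (u : U) : W := Wreath u (@wr_one_finsupp A U).

Lemma wr_deltaM : {morph wr_delta : a b / a * b}.
Proof.
move=> a b; apply: wreathP => [x|] /=; last by rewrite mulg1.
by rewrite invg1 mul1g; case: eqP; rewrite ?mulg1.
Qed.

Lemma wr_translationM : {morph wr_translation : u v / u * v}.
Proof. by move=> u v; apply: wreathP => [x|] //=; rewrite mulg1. Qed.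

Lemma wr_delta1 : wr_delta 1 = 1.
Proof. by apply: wreathP => [x|] //=; case: ifP. Qed.

(** A wreath product is generated by the top group and the copy of A at 1:
conjugating by translations reaches the other points, one at a time along the
support. *)
Lemma wreath_ind (K : set W) : is_subgroup K ->
  (forall a, K (wr_delta a)) -> (forall u, K (wr_translation u)) ->
  forall p, K p.
Proof.
move=> sK Kd Kt p.
have [s sP] : exists s : seq U, forall x, wr_base p x != 1 -> x \in s.
  exists (fset_set [set x | wr_base p x != 1]) => x px.
  by rewrite in_fset_set ?inE //; exact: wr_finsupp.
elim: s p sP => [|y s IH] p sP.
  suff -> : p = wr_translation (wr_top p) by [].
  apply: wreathP => //= x; apply: contrapT => /eqP/sP; by [].
pose a := wr_base p y.
have [q [Kq qE qtop]] : exists q, [/\ K q,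
    forall x, wr_base q x = if x == y then a else 1 & wr_top q = 1].
  pose q := wr_translation y * wr_delta a * wr_translation y^-1.
  exists q; split; last by rewrite /= mulg1 mulgV.
    by apply: (is_subgroupM sK) => //; apply: (is_subgroupM sK).
  move=> x; rewrite /= mul1g mulg1 -(inj_eq (mulgI y)) mulVKg mulg1.
  by case: eqP.
rewrite -[p](mulVKg q); apply: (is_subgroupM sK Kq); apply: IH => x.
have -> : wr_base (q^-1 * p) x =
  (wr_base q (wr_top q * x))^-1 * wr_base p ((wr_top q)^-1^-1 * x) by [].
rewrite qtop invgK !mul1g qE; have [->|xy] := eqVneq x y.
  by rewrite mulVg eqxx.
by rewrite invg1 mul1g => /sP; rewrite inE (negPf xy).
Qed.

Lemma wreath_fg : finitely_generated [set: A] -> finitely_generated [set: U] ->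
  finitely_generated [set: W].
Proof.
move=> [S [Sf AS]] [T [Tf UT]].
exists (wr_delta @` S `|` wr_translation @` T); split.
  by rewrite finite_setU; split; exact: finite_image.
apply/seteqP; split=> // p _.
set Gn := generated _; have sG : is_subgroup Gn by exact: generated_subgroup.
apply: wreath_ind => // a.
  have sub : generated S `<=` wr_delta @^-1` Gn.
    apply: (generated_ind (preimage_subgroup wr_deltaM sG)) => b Sb.
    by apply: sub_generated; left; exists b.
  by apply: sub; rewrite -AS.
have sub : generated T `<=` wr_translation @^-1` Gn.
  apply: (generated_ind (preimage_subgroup wr_translationM sG)) => u Tu.
  by apply: sub_generated; right; exists u.
by apply: sub; rewrite -UT.
Qed.

End WreathGenerators.

Section Tilings.
Variables (U : groupType) (Y : Type) (R : recursion U Y).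

(** Copies of U indexed by the letters sit inside U, and the left translation
action on U is the recursion R acting on the copies and inside them.  The last
field keeps an element supported at 1 supported there under restriction. *)
Record tiling := Tiling {
  tile_map :> Y -> U -> U;
  tiling_inj : forall y, injective (tile_map y);
  tiling_equivariant : forall u y z,
    u^-1 * tile_map y z = tile_map (ract R u y) ((rsec R u y)^-1 * z);
  tiling_eq1 : forall y z, tile_map y z = 1 -> z = 1 }.

Definition tile_word (t : tiling) (w : seq Y) (z : U) : U := foldr t z w.

Definition separating (t : tiling) := forall z z', z <> z' ->
  exists w v, z = tile_word t w v /\ forall v', z' <> tile_word t w v'.

Lemma tile_word_inj t w : injective (tile_word t w).
Proof. by elim: w => //= y w IH z z' /tiling_inj/IH. Qed.

Lemma tile_word_cat t v w z :
  tile_word t (v ++ w) z = tile_word t v (tile_word t w z).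
Proof. exact: foldr_cat. Qed.

End Tilings.

Section FiniteSums.
Variables (A : zmodType) (U : groupType).
Implicit Types (f g : U -> A).
Import GRing.Theory.
Local Open Scope ring_scope.

Lemma fsum_supp f (s : seq U) : uniq s -> (forall x, f x != 0 -> x \in s) ->
  \sum_(x \in [set: U]) f x = \sum_(x <- s) f x.
Proof.
move=> su sP; rewrite (fsbigE s) //.
  by apply: eq_bigl => x; rewrite in_setT.
by move=> x _; apply: contraNeq => /sP.
Qed.

Lemma fsumD f g :
  finite_set [set x | f x != 0] -> finite_set [set x | g x != 0] ->
  \sum_(x \in [set: U]) (f x + g x) =
  \sum_(x \in [set: U]) f x + \sum_(x \in [set: U]) g x.
Proof.
move=> fF gF.
set s : seq U := fset_set ([set x | f x != 0] `|` [set x | g x != 0]).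
have sF x : f x != 0 -> x \in s.
  by move=> fx; rewrite in_fset_set ?finite_setU // inE; left.
have sG x : g x != 0 -> x \in s.
  by move=> fx; rewrite in_fset_set ?finite_setU // inE; right.
rewrite !(@fsum_supp _ s) ?fset_uniq ?big_split //.
move=> x; apply: contraNT => xs.
by rewrite (contraNeq (@sF x) xs) (contraNeq (@sG x) xs) addr0.
Qed.

(** If f does not vanish on some iterated tile, then either its support there is
one point, and the sum over the tile is the value of f at that point, or a
smaller tile loses one of two points of the support.  The list s bounds the
support of f on the tile. *)
Lemma tile_sums_eq0 (Y : Type) (R : recursion U Y) (t : tiling R) f :
  separating t -> finite_set [set x | f x != 0] ->
  (forall w, \sum_(z \in [set: U]) f (tile_word t w z) = 0) ->
  forall x, f x = 0.
Proof.
move=> tsep fF fw.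
suff H k w (s : seq U) : (size s < k)%N ->
    (forall z, f (tile_word t w z) != 0 -> tile_word t w z \in s) ->
    forall z, f (tile_word t w z) = 0.
  move=> x; apply: (H _ [::] (fset_set [set x | f x != 0]) (ltnSn _)) => z fz.
  by rewrite in_fset_set // inE.
elim: k w s => // k IH w s sk ws z; apply: contrapT => /eqP fz.
have [[z' [/eqP zz' fz']]|one] :=
    pselect (exists z', z != z' /\ f (tile_word t w z') != 0).
  have [v [y [zE z'N]]] := tsep z z' zz'.
  have wvE x : tile_word t (w ++ v) x = tile_word t w (tile_word t v x).
    exact: tile_word_cat.
  suff : f (tile_word t w z) = 0 by apply/eqP.
  rewrite zE -wvE; apply: (IH _ [seq x <- s | x != tile_word t w z']).
    rewrite ltnS in sk; apply: leq_trans sk; rewrite size_filter.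
    rewrite -(count_predC (pred1 (tile_word t w z')) s).
    by rewrite -[ltnLHS]add0n ltn_add2r -has_count has_pred1; apply: ws.
  move=> x; rewrite wvE => /ws xs; rewrite mem_filter xs andbT.
  apply/eqP => /tile_word_inj xz'; exact: (z'N x).
have := fw w; rewrite (@fsum_supp _ [:: z]) //.
  by rewrite big_seq1; exact/eqP.
move=> z' fz'; rewrite inE eq_sym; apply: contrapT => /negP zz'.
by apply: one; exists z'.
Qed.

End FiniteSums.

Section WreathRecursion.
Variables (A : zmodType) (U : groupType) (X Y : Type).
Local Notation M := (Algebra.to_multiplicative A).
Local Notation W := (wreath M U).
Variables (RA : recursion M X) (RU : recursion U Y) (t : tiling RU).
Implicit Types (p q : W) (y : Y).
Import GRing.Theory.

Lemma wr_restrict_finsupp p y :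
  finite_set [set z | wr_base p (t y z) != 1].
Proof.
apply: (@finite_preimage _ _ [set x | wr_base p x != 1] (t y)).
  by move=> ? ? _ _; exact: tiling_inj.
exact: wr_finsupp.
Qed.

Definition wr_restrict p y : W :=
  Wreath (rsec RU (wr_top p) y) (wr_restrict_finsupp p y).

(** The identity needed for the base functions is exactly the equivariance of
the tiling. *)
Definition restrict_rec : recursion W Y.
Proof.
refine (@Recursion W Y (fun p => ract RU (wr_top p)) wr_restrict _ _ _).
- exact: ract1.
- by move=> p q y; exact: ractM.
move=> p q y; apply: wreathP => [z|] /=; last exact: rsecM.
by rewrite tiling_equivariant.
Defined.

Definition wr_total p : M := (\sum_(x \in [set: U]) (wr_base p x : A))%R.

Lemma wr_totalM : {morph wr_total : p q / p * q}.
Proof.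
move=> p q.
have shift_bij : bijective (fun x : U => (wr_top p)^-1 * x).
  by exists (fun x => wr_top p * x) => x; rewrite ?mulKg ?mulVKg.
rewrite /wr_total.
rewrite [X in _ = _ * X](@reindex_fsbigT _ _ _ _ _ _ (wr_base q : U -> A)
  shift_bij).
apply: fsumD; first exact: wr_finsupp.
apply: (@finite_preimage _ _ [set x | wr_base q x != 1]
          (fun x => (wr_top p)^-1 * x)); last exact: wr_finsupp.
by move=> ? ? _ _; exact: bij_inj.
Qed.

Lemma wr_total_delta : cancel (@wr_delta M U) wr_total.
Proof.
move=> a; rewrite /wr_total (@fsum_supp A U _ [:: 1]) //.
  by rewrite big_seq1 /= eqxx.
by move=> x; rewrite inE /=; have [|_] := eqVneq x 1; rewrite ?eqxx.
Qed.

Definition wreath_rec : recursion W (Y + X) :=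
  sum_rec restrict_rec (pull_rec RA wr_totalM (@wr_deltaM M U)).

Lemma wr_base_restrict_word p w z :
  wr_base (foldl wr_restrict p w) z = wr_base p (tile_word t w z).
Proof. by elim: w p => //= y w IH p; rewrite IH. Qed.

(** Both parts are used jointly: the first provides the restrictions to all
iterated tiles, the second the sums of these restrictions. *)
Lemma wreath_rec_faithful :
  faithful RU -> separating t -> faithful RA -> faithful wreath_rec.
Proof.
move=> RUf tsep RAf p pP.
have total0 q : fixes_words wreath_rec q -> wr_total q = 0%R.
  move=> /fixes_words_sum[_ /fixes_words_pull qP].
  by apply: RAf; apply: qP; exact: wr_total_delta.
have restrictP w : fixes_words wreath_rec (foldl wr_restrict p w).
  elim: w (p) pP => //= y w IH q qP; apply: IH.
  exact: (@fixes_words_sec _ _ wreath_rec q (inl y)).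
apply: wreathP => [|]; last first.
  apply: RUf => w; have [+ _] := fixes_words_sum pP => /(_ w).
  suff -> : word_act restrict_rec p w = word_act RU (wr_top p) w.
    by [].
  by elim: w (p) => //= y w IH q; rewrite IH.
apply: (tile_sums_eq0 tsep); first exact: wr_finsupp.
move=> w; rewrite -[RHS](total0 _ (restrictP w)).
by apply: eq_fsbigr => z _; rewrite wr_base_restrict_word.
Qed.

Lemma wr_delta_restrict a y :
  wr_restrict (wr_delta U a) y = wr_delta U a \/
  wr_restrict (wr_delta U a) y = 1.
Proof.
have eq1 z : t y z = 1 -> z = 1 by exact: tiling_eq1.
have [ty|ty] := eqVneq (t y 1) 1; [left|right];
  apply: wreathP => [z|] /=; rewrite ?rsec1 //.
  by have -> : (t y z == 1) = (z == 1) by apply/eqP/eqP => [/eq1|->].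
have [tz|//] := eqVneq (t y z) 1.
by move: ty; rewrite -[in t y _](eq1 z tz) tz eqxx.
Qed.

Lemma wreath_rec_finite_delta a :
  finite_sections RA a -> finite_sections wreath_rec (wr_delta U a).
Proof.
move=> [S [Sf Sa Ss]]; exists (1 |` @wr_delta M U @` S); split.
- by rewrite finite_setU; split; [exact: finite_set1 | exact: finite_image].
- by right; exists a.
move=> _ x [->|[b Sb <-]]; first by left; exact: rsec1.
case: x => [y|x] /=.
  have [->|->] := wr_delta_restrict b y; last by left.
  by right; exists b.
right; exists (rsec RA b x); first exact: Ss.
by rewrite wr_total_delta.
Qed.

Lemma wreath_rec_finite_translation u :
  finite_sections RU u -> finite_sections wreath_rec (wr_translation M u).
Proof.
move=> [S [Sf Su Ss]]; exists (1 |` @wr_translation M U @` S); split.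
- by rewrite finite_setU; split; [exact: finite_set1 | exact: finite_image].
- by right; exists u.
move=> _ x [->|[v Sv <-]]; first by left; exact: rsec1.
case: x => [y|x] /=.
  by right; exists (rsec RU v y); [exact: Ss | exact: wreathP].
left; have -> : wr_total (wr_translation M v) = 1 by apply: fsbig1.
by rewrite rsec1 wr_delta1.
Qed.

Lemma wreath_rec_finite :
  (forall a, finite_sections RA a) -> (forall u, finite_sections RU u) ->
  forall p, finite_sections wreath_rec p.
Proof.
move=> RAf RUf; apply: wreath_ind; first exact: finite_sections_subgroup.
  by move=> a; exact: wreath_rec_finite_delta.
by move=> u; exact: wreath_rec_finite_translation.
Qed.

End WreathRecursion.

Section OdometerTiling.
Variable n : nat.
Import GRing.Theory.

Definition odometer_tiling : tiling (odometer n).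
Proof.
refine (@Tiling _ _ (odometer n) (@tile n) (@tile_inj n) _ (@tile_eq0 n)).
move=> u x z; have := tile_equivariant u x z.
by rewrite addrC [X in _ = tile _ X]addrC.
Defined.

(** Two points that no iterated tile separates have the same parity, and
dividing them gives another such pair; their difference is thus divisible
forever. *)
Lemma odometer_tiling_separating : separating odometer_tiling.
Proof.
move=> z z' zz'; apply: contrapT => nsep; apply: zz'.
pose D (v : 'rV[int]_n.+1) := exists y y' : 'rV[int]_n.+1, v = (y - y')%R /\
  ~ exists w z, y = tile_word odometer_tiling w z /\
      forall z', y' <> tile_word odometer_tiling w z'.
apply/eqP; rewrite -GRing.subr_eq0; apply/eqP.
apply: (@shift_divisible0 n D); last by exists z, z'.
move=> _ [y [y' [-> ns]]].
have [x [v yE]] := tile_surj y; have [x' [v' y'E]] := tile_surj y'.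
have xx' : x = x'.
  apply: contrapT => xx'; apply: ns; exists [:: x], v; split=> //= s y's.
  by apply: xx'; rewrite -(parity_tile x s) -(parity_tile x' v') -y'E y's.
exists (v - v')%R.
  by rewrite yE y'E xx' /tile shiftB opprB addrA subrK.
exists v, v'; split=> // -[w [s [vE v'N]]]; apply: ns.
exists (x :: w), s; split=> [|s']; first by rewrite yE vE.
by rewrite y'E xx' => /tile_inj; exact: v'N.
Qed.

End OdometerTiling.

(** The base group contributes its own letters and the top group two more. *)
Theorem wreath_automata (A : zmodType) (d : nat) (X : finType)
    (R : recursion (Algebra.to_multiplicative A) X) : (1 <= d)%N ->
  finitely_generated [set: Algebra.to_multiplicative A] ->
  faithful R -> (forall a, finite_sections R a) ->
  is_automata_group (2 + #|X|)
    (wreath (Algebra.to_multiplicative A) (free_abelian d)).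
Proof.
case: d => // n _ Afg Rf Rfin; rewrite -card_bool -card_sum.
apply: (@recursion_automata _ _ (wreath_rec R (odometer_tiling n))).
- exact/wreath_fg/free_abelian_fg.
- apply: wreath_rec_faithful => //; first exact: odometer_faithful.
  exact: odometer_tiling_separating.
by apply: wreath_rec_finite => //; exact: odometer_finite.
Qed.

(** * Finitely generated abelian groups *)

Section FinitelyGeneratedAbelian.
Variable A : zmodType.
Import GRing.Theory Num.Theory.
Local Open Scope ring_scope.
Implicit Types (a b : A).

Lemma torsion0 : torsion A 0.
Proof. by exists 1%N; rewrite mul0rn. Qed.

Lemma torsionB a b : torsion A a -> torsion A b -> torsion A (a - b).
Proof.
move=> [m [m0 am]] [n [n0 bn]]; exists (m * n)%N.
rewrite muln_gt0 m0; split=> //.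
by rewrite mulrnBl mulrnA am mul0rn mulnC mulrnA bn mul0rn subr0.
Qed.

Lemma torsionN a : torsion A a -> torsion A (- a).
Proof. by rewrite -sub0r; apply: torsionB; exact: torsion0. Qed.

Lemma torsionD a b : torsion A a -> torsion A b -> torsion A (a + b).
Proof. by move=> aT /torsionN bT; rewrite -[b]opprK; exact: torsionB. Qed.

Lemma torsionMz a k : torsion A a -> torsion A (a *~ k).
Proof.
move=> [n [n0 an]]; exists n; split=> //.
by rewrite pmulrn mulrzAC -pmulrn an mul0rz.
Qed.

Lemma torsion_saturated a k : k != 0 -> torsion A (a *~ k) -> torsion A a.
Proof.
move=> k0 [n [n0 an]]; exists (`|k| * n)%N.
rewrite muln_gt0 absz_gt0 k0 n0; split=> //.
rewrite mulrnA; case: k an {k0} => m //=.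
by rewrite NegzE mulrNz mulNrn => /eqP; rewrite oppr_eq0 => /eqP.
Qed.

Definition comb n (x : 'I_n -> A) (c : 'rV[int]_n) : A :=
  \sum_i x i *~ c 0 i.

Lemma comb_is_additive n (x : 'I_n -> A) : {morph comb x : c e / c - e}.
Proof.
move=> c e; rewrite /comb -sumrB; apply: eq_bigr => i _.
by rewrite !mxE mulrzBr.
Qed.

HB.instance Definition _ n (x : 'I_n -> A) :=
  GRing.isZmodMorphism.Build 'rV[int]_n A (comb x) (@comb_is_additive n x).

Lemma comb_mulmx m n (x : 'I_n -> A) (c : 'rV[int]_m) (R : 'M[int]_(m, n)) :
  comb x (c *m R) = comb (fun i => comb x (row i R)) c.
Proof.
rewrite /comb; under [RHS]eq_bigr => i _ do rewrite mulrz_suml.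
rewrite exchange_big; apply: eq_bigr => j _ /=.
rewrite mxE mulrz_sumr; apply: eq_bigr => i _.
by rewrite !mxE mulrC mulrzA.
Qed.

Lemma comb_recl n (x : 'I_n.+1 -> A) c :
  comb x c = x ord0 *~ c 0 ord0
           + comb (x \o lift ord0) (\row_i c 0 (lift ord0 i)).
Proof.
rewrite /comb big_ord_recl; congr (_ + _).
by apply: eq_bigr => i _; rewrite mxE.
Qed.

Definition generates_mod_torsion n (x : 'I_n -> A) :=
  forall a, exists c, torsion A (a - comb x c).

Definition free_mod_torsion n (x : 'I_n -> A) :=
  forall c, torsion A (comb x c) -> c = 0.

(** Modulo torsion a relation may be divided by the gcd of its coefficients, and
a primitive integer vector is part of a basis: by the Smith normal form of the
single row c, a unimodular change of generators makes c a multiple of the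
first coordinate.  The first new generator is then torsion and can be
dropped. *)
Lemma free_mod_torsion_exists n (x : 'I_n -> A) : generates_mod_torsion x ->
  exists r (y : 'I_r -> A), generates_mod_torsion y /\ free_mod_torsion y.
Proof.
elim: n x => [|n IH] x xgen.
  by exists 0%N, x; split=> // c _; exact: thinmx0.
have [xfree|/existsNP[c /not_implyP[cT c0]]] := pselect (free_mod_torsion x).
  by exists n.+1, x.
have [L _ [R Ru [d _ cE]]] := int_Smith_normal_form c.
pose y i := comb x (row i R).
pose k := L 0 0 * d`_0.
(* In the generators y, the relation c reads k y_0. *)
have LDE : c *m invmx R = k *: delta_mx 0 ord0.
  rewrite cE mulmxK //; apply/rowP => j; rewrite !mxE big_ord1 !mxE /=.
  rewrite /k -mulrA mulr_natr -(inj_eq val_inj) /= eq_sym.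
  by congr (L 0 _ * _); exact: ord1.
have k0 : k != 0.
  apply/eqP => k0; apply: c0.
  by rewrite -[c](mulmxKV Ru) LDE k0 scale0r mul0mx.
have y0T : torsion A (y ord0).
  apply: (torsion_saturated k0); move: cT.
  rewrite -[c](mulmxKV Ru) comb_mulmx LDE comb_recl !mxE eqxx mulr1.
  rewrite (_ : \row_i _ = 0) ?raddf0 ?addr0 //.
  by apply/rowP => i; rewrite !mxE mulr0.
apply: (IH (y \o lift ord0)) => a; have [e aT] := xgen a.
exists (\row_i (e *m invmx R) 0 (lift ord0 i)).
move: aT; rewrite -[e in comb x e](mulmxKV Ru) comb_mulmx comb_recl.
set z := comb _ (\row_i _); set w := _ *~ _ => aT.
have -> : a - z = (a - (w + z)) + w by rewrite opprD addrA addrAC subrK.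
by apply: torsionD aT _; exact: torsionMz.
Qed.

(** The coefficients matter only modulo a common exponent K of the x_i. *)
Lemma comb_range_torsion_finite n (x : 'I_n -> A) :
  (forall i, torsion A (x i)) -> finite_set (range (comb x)).
Proof.
move=> xT; pose N i := projT1 (cid (xT i)).
have NP i : (0 < N i)%N /\ x i *+ N i = 0 by exact: (projT2 (cid (xT i))).
pose K := \prod_i N i.
have K0 : (0 < K)%N by apply: prodn_gt0 => i; case: (NP i).
have xK i : x i *+ K = 0.
  by rewrite /K (bigD1 i) //= mulrnA (NP i).2 mul0rn.
pose F (f : {ffun 'I_n -> 'I_K}) := \sum_i x i *+ f i.
apply: (@sub_finite_set _ _ (range F)); last exact/finite_image/finite_finset.
move=> _ [c _ <-].
have cK i : (`|(c 0%R i %% K)%Z| < K)%N.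
  by rewrite -ltz_nat gez0_abs ?modz_ge0 ?ltz_pmod //; lia.
exists [ffun i => Ordinal (cK i)] => //.
apply: eq_bigr => i _; rewrite ffunE /=.
rewrite pmulrn gez0_abs ?modz_ge0 //; last by lia.
rewrite [in RHS](divz_eq (c 0 i) K) [in RHS]mulrzDr [(_ * _)%R]mulrC mulrzA.
by rewrite -pmulrn xK mul0rz add0r.
Qed.

Lemma fg_comb : finitely_generated [set: Algebra.to_multiplicative A] ->
  exists n (x : 'I_n -> A), range (comb x) = [set: A].
Proof.
move=> [S [Sf AS]]; pose s : seq A := fset_set S.
exists (size s), (fun i => s`_i); apply/seteqP; split=> // a.
suff : generated (G := Algebra.to_multiplicative A) S `<=`
    range (comb (fun i : 'I_(size s) => s`_i)).
  by rewrite -AS => sub aA; exact: sub.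
apply: generated_ind => [|b Sb].
  split; first by exists 0 => //; rewrite raddf0.
  by move=> _ _ [c _ <-] [e _ <-]; exists (c - e) => //; rewrite raddfB.
have bs : b \in s by rewrite in_fset_set // inE.
have ib : (index b s < size s)%N by rewrite index_mem.
exists (delta_mx 0 (Ordinal ib)) => //.
rewrite /comb (bigD1 (Ordinal ib)) //= big1 ?addr0.
  by rewrite mxE !eqxx nth_index.
by move=> i /negPf ii; rewrite mxE ii andbF mulr0z.
Qed.

(** The coordinates of a on a basis modulo torsion are unique, hence additive in
a; the complementary projection onto the torsion subgroup makes the latter
generated by finitely many torsion elements, hence finite. *)
Theorem fg_abelian_split :
  finitely_generated [set: Algebra.to_multiplicative A] ->
  finite_set (torsion A) /\
  exists r (p : {additive A -> 'rV[int]_r}) (s : {additive 'rV[int]_r -> A}),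
    cancel s p /\ forall a, torsion A (a - s (p a)).
Proof.
move=> /fg_comb[n [x xA]].
have xgen : generates_mod_torsion x.
  move=> a; have : range (comb x) a by rewrite xA.
  by case=> c _ <-; exists c; rewrite subrr; exact: torsion0.
have [r [y [ygen yfree]]] := free_mod_torsion_exists xgen.
pose p a := projT1 (cid (ygen a)).
have pT a : torsion A (a - comb y (p a)) by exact: (projT2 (cid (ygen a))).
have pE a c : torsion A (a - comb y c) -> p a = c.
  move=> aT; apply/eqP; rewrite -subr_eq0; apply/eqP/yfree.
  rewrite (raddfB (comb y)).
  have -> : comb y (p a) - comb y c = (a - comb y c) - (a - comb y (p a)).
    by rewrite opprB [RHS]addrC addrA subrK.
  by apply: torsionB => //; exact: pT.
have pB : {morph p : a b / a - b}.
  move=> a b; apply: pE; rewrite (raddfB (comb y)) opprD addrACA -opprD.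
  exact: torsionB.
pose p' := HB.pack_for {additive A -> 'rV[int]_r} p
  (GRing.isZmodMorphism.Build _ _ p pB).
split; last first.
  exists r, p', (comb y); split=> // c.
  by apply: pE; rewrite subrr; exact: torsion0.
pose t a := a - comb y (p a).
apply: (@sub_finite_set _ _ (range (comb (t \o x)))); last first.
  by apply: comb_range_torsion_finite => i; exact: pT.
move=> a aT; have : range (comb x) a by rewrite xA.
case=> c _ ca; exists c => //.
have pcomb : \sum_i comb y (p (x i)) *~ c 0 i = comb y (p a).
  rewrite -ca -[p]/(p' : A -> _) !raddf_sum; apply: eq_bigr => i _.
  by rewrite !raddfMz.
have pa : p a = 0 by apply: pE; rewrite raddf0 subr0.
rewrite /comb; under eq_bigr => i _ do rewrite mulrzBl.
by rewrite sumrB pcomb pa raddf0 subr0.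
Qed.

End FinitelyGeneratedAbelian.

(** * The theorem *)

Section AbelianRecursion.
Variables (A : zmodType).
Hypothesis torsion_fin : finite_set (torsion A).
Variables (r : nat) (p : {additive A -> 'rV[int]_r}).
Variables (s : {additive 'rV[int]_r -> A}).
Hypotheses (sK : cancel s p) (spT : forall a, torsion A (a - s (p a))%R).
Local Notation M := (Algebra.to_multiplicative A).
Local Notation T := (fset_set (torsion A)).
Import GRing.Theory.

Definition torsion_part (a : A) : A := (a - s (p a))%R.

Lemma torsion_part0 : torsion_part 0 = 0%R.
Proof. by rewrite /torsion_part !raddf0 addr0. Qed.

Lemma torsion_partD (a b : A) :
  torsion_part (a + b) = (torsion_part a + torsion_part b)%R.
Proof. by rewrite /torsion_part (raddfD p) (raddfD s) opprD addrACA. Qed.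

Lemma torsion_translate_subproof (a : A) (b : T) :
  ((val b + torsion_part a)%R \in T).
Proof.
rewrite in_fset_set // inE; apply: torsionD; last exact: spT.
by have := valP b; rewrite in_fset_set // inE.
Qed.

Definition torsion_translate (a : M) (x : bool * T) : bool * T :=
  (x.1, [` torsion_translate_subproof a x.2]%fset).

Lemma torsion_translate1 x : torsion_translate 1 x = x.
Proof.
case: x => b c; congr pair; apply: val_inj => /=.
by change (val c + torsion_part 0 = val c)%R; rewrite torsion_part0 addr0.
Qed.

Lemma torsion_translateM a b x :
  torsion_translate (a * b) x = torsion_translate b (torsion_translate a x).
Proof.
case: x => e c; congr pair; apply: val_inj => /=.
change (val c + torsion_part ((a : A) + b)
        = val c + torsion_part a + torsion_part b)%R.
by rewrite torsion_partD addrA.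
Qed.

(** The torsion part of an element is seen on the letters of bool * T, the
free part on the odometer. *)
Lemma abelian_recursion : exists R : recursion M (bool + bool * T),
  faithful R /\ forall a, finite_sections R a.
Proof.
have [F [Ff Ffin]] := free_abelian_recursion r.
have pM : {morph (p : M -> free_abelian r) : a b / a * b} by exact: raddfD.
have sM : {morph (s : free_abelian r -> M) : a b / a * b} by exact: raddfD.
exists (sum_rec (pull_rec F pM sM)
                (perm_rec torsion_translate1 torsion_translateM)); split.
  move=> a /fixes_words_sum[aF aT].
  have pa : p a = 0%R by apply: Ff; apply: (fixes_words_pull _ aF).
  have T0 : (0%R : A) \in T by rewrite in_fset_set // inE; exact: torsion0.
  (* The translation by the torsion part of a is read off the image of 0. *)
  have := aT [:: (true, [` T0]%fset)] => /= -[].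
  by rewrite add0r /torsion_part pa raddf0 subr0.
move=> a; have [S [Sf Sa Ss]] := Ffin (p a).
exists ([set (1 : M); a] `|` s @` S); split; last first.
- move=> b x [[->|->]|[c Sc <-]]; first by left; left; exact: rsec1.
    case: x => x /=; last by left; left.
    by right; exists (rsec F (p a) x) => //; exact: Ss.
  case: x => x /=; last by left; left.
  by right; exists (rsec F c x); [exact: Ss | rewrite sK].
- by left; right.
by rewrite finite_setU; split; [exact: finite_set2|exact: finite_image].
Qed.

End AbelianRecursion.

Theorem theoremC (d : nat) (d_ge1 : (1 <= d)%N) :
  (forall A : zmodType,
     finitely_generated [set: Algebra.to_multiplicative A] ->
     finite_set (torsion A) /\
     is_automata_group (2 * #|` fset_set (torsion A)| + 4)%N
       (wreath (Algebra.to_multiplicative A) (free_abelian d))) /\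
  (forall l : nat, (1 <= l)%N ->
     is_automata_group 4 (wreath (free_abelian l) (free_abelian d))).
Proof.
split=> [A Afg|l _].
  have [Tfin [r [p [s [sK spT]]]]] := fg_abelian_split Afg.
  split=> //; have [R [Rf Rfin]] := abelian_recursion Tfin sK spT.
  have := wreath_automata d_ge1 Afg Rf Rfin.
  rewrite card_sum card_prod card_bool -cardfE.
  by rewrite addnA addnC.
have [R [Rf Rfin]] := free_abelian_recursion l.
have := wreath_automata d_ge1 (free_abelian_fg l) Rf Rfin.
by rewrite card_bool.
Qed.
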